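(* Let $\mathcal{F}\subseteq\{0,1\}^n$ be nonempty, and let $\boldsymbol{A}\boldsymbol{x}+\boldsymbol{B}\boldsymbol{z}\le\boldsymbol{b}$ be an extended formulation of $\operatorname{conv}(\mathcal{F})$. Then $$\bigl\{(y_0,\boldsymbol{y},\boldsymbol{z}) : \boldsymbol{A}\boldsymbol{y}+\boldsymbol{B}\boldsymbol{z}\le \boldsymbol{b}\,y_0,\ (y_0,\boldsymbol{y})\in H,\ y_0\ge 0\bigr\}$$ is an extended formulation of $\operatorname{conv}(\Pi(\mathcal{F}))$, i.e. its projection onto the $(y_0,\boldsymbol{y})$ variables equals $\operatorname{conv}(\Pi(\mathcal{F}))$. Moreover, if $\operatorname{conv}(\mathcal{F})$ admits a compact extended formulation, then so does $\operatorname{conv}(\Pi(\mathcal{F}))$.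
   Context: $N=\{1,\dots,n\}$; $u_0>0$ and $u_j\ge 0$ for $j\in N$ are given preference weights. The choice probability set over $\mathcal{F}$ is $$\Pi(\mathcal{F})=\Bigl\{(y_0,\boldsymbol{y})\in\mathbb{R}^{n+1}: u_0y_0+\sum_{j\in N}u_jy_j=1,\ \boldsymbol{y}\in y_0\cdot\mathcal{F},\ y_0>0\Bigr\},$$ where $\lambda\cdot S=\{\lambda\boldsymbol{x}:\boldsymbol{x}\in S\}$, and $H=\{(y_0,\boldsymbol{y})\in\mathbb{R}^{n+1}: u_0y_0+\sum_{j\in N}u_jy_j=1\}$. A system of linear inequalities $\boldsymbol{A}\boldsymbol{x}+\boldsymbol{B}\boldsymbol{z}\le \boldsymbol{b}$ in $(\boldsymbol{x},\boldsymbol{z})\in\mathbb{R}^{n+q}$ is an extended formulation of a polytope $P\subseteq\mathbb{R}^n$ if $P=\{\boldsymbol{x}:\exists \boldsymbol{z}\in\mathbb{R}^q,\ \boldsymbol{A}\boldsymbol{x}+\boldsymbol{B}\boldsymbol{z}\le\boldsymbol{b}\}$ (analogously for polytopes in $\mathbb{R}^{n+1}$; an equality counts as two inequalities). It is compact if both $q$ and the number of inequalities are polynomial in $n$ (understood for families of sets $\mathcal{F}$ indexed by $n$). *)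

(* Defs.v *)
From HB Require Import structures.
From mathcomp Require Import all_boot all_order all_algebra.
From mathcomp Require Import all_classical all_reals convex.

Set Implicit Arguments.
Unset Strict Implicit.
Unset Printing Implicit Defensive.
Import Order.TTheory GRing.Theory Num.Theory.

Local Open Scope classical_set_scope.
Local Open Scope ring_scope.

Definition conv_hull (R : realType) d (S : set 'cV[R]_d) : set 'cV[R]_d :=
  smallest (@convex_set R 'cV[R]_d) S.

Definition polytope (R : realType) d (P : set 'cV[R]_d) : Prop :=
  exists2 V : set 'cV[R]_d, finite_set V & P = conv_hull V.

Definition binary_vectors (R : realType) n : set 'cV[R]_n :=
  [set x | forall j, x j 0 = 0 \/ x j 0 = 1].

Definition lin_sys (R : realType) m d q
    (A : 'M[R]_(m, d)) (B : 'M[R]_(m, q)) (b : 'cV[R]_m) :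
    set ('cV[R]_d * 'cV[R]_q) :=
  [set xz | forall i, (A *m xz.1 + B *m xz.2) i 0 <= b i 0].

(* A system of linear inequalities is identified with its solution set Q, so
   that it may also be given in the form of a set comprehension; the parameter m
   records that Q is cut out by m inequalities, an equality counting as two. *)
Definition extended_formulation (R : realType) m d q
    (Q : set ('cV[R]_d * 'cV[R]_q)) (P : set 'cV[R]_d) : Prop :=
  [/\ polytope P,
      exists (A : 'M[R]_(m, d)) (B : 'M[R]_(m, q)) (b : 'cV[R]_m),
        Q = lin_sys A B b
    & P = [set x | exists z, Q (x, z)]].

(* The n-th polytope lives in dimension d n, but sizes are measured as functions
   of the index n. *)
Definition has_compact_ef (R : realType) (d : nat -> nat)
    (P : forall n, set 'cV[R]_(d n)) : Prop :=
  exists p : {poly nat}, forall n,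
  exists q m (Q : set ('cV[R]_(d n) * 'cV[R]_q)),
    [/\ (q <= p.[n])%N, (m <= p.[n])%N & extended_formulation m Q (P n)].

(* A vector (y_0, y) of R^(n+1) is a column Y of height 1 + n whose first entry
   is y_0 and whose last n entries form y. *)
Definition y0_part (R : realType) n (Y : 'cV[R]_(1 + n)) : R := usubmx Y 0 0.

Definition y_part (R : realType) n (Y : 'cV[R]_(1 + n)) : 'cV[R]_n := dsubmx Y.

Definition hyperplaneH (R : realType) n (u0 : R) (u : 'I_n -> R) :
    set 'cV[R]_(1 + n) :=
  [set Y | u0 * y0_part Y + \sum_(j < n) u j * y_part Y j 0 = 1].

Definition choice_prob (R : realType) n (u0 : R) (u : 'I_n -> R)
    (F : set 'cV[R]_n) : set 'cV[R]_(1 + n) :=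
  [set Y | [/\ u0 * y0_part Y + \sum_(j < n) u j * y_part Y j 0 = 1,
               [set y0_part Y *: x | x in F] (y_part Y)
             & 0 < y0_part Y]].

(* Main.v *)
Require Import Defs.
From mathcomp Require Import all_boot all_order all_algebra.
From mathcomp Require Import all_classical all_reals convex.
From mathcomp Require Import interval_inference ring lra.

Set Implicit Arguments.
Unset Strict Implicit.
Unset Printing Implicit Defensive.
Import Order.TTheory GRing.Theory Num.Theory.

Local Open Scope classical_set_scope.
Local Open Scope ring_scope.

(** The perspective map x |-> (1, x) / (u_0 + u.x), here [choice_vector], sends
    F onto Pi(F) ([choice_probE]).  It is projective, so it sends a convex
    combination of x and y to another convex combination of their images, with
    the weights redistributed in proportion to u_0 + u.x and u_0 + u.y
    ([choice_vector_conv]).  Hence it maps conv(F) into conv(Pi(F))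
    ([choice_vector_conv_hull]).

    Let (y_0, y, z) satisfy the homogenized system.  If y_0 > 0, then y / y_0
    satisfies the original system (with witness z / y_0), so it lies in conv(F);
    the equation of H forces 1 / y_0 = u_0 + u.(y / y_0), so (y_0, y) is the
    image of y / y_0 and lies in conv(Pi(F)).  If y_0 = 0, then y is a recession
    direction of conv(F), which sits inside the unit cube, so y = 0
    ([recession_unit_cube]) and the equation of H reads 0 = 1, a contradiction.
    Conversely, the projection of the homogenized system is convex and contains
    Pi(F), hence contains its hull.  This is [proj_homogenization].

    The hull of Pi(F) is a polytope because F, and hence Pi(F), is finite.  The
    homogenized system has three more inequalities than the original one and the
    same number of extra variables, so compactness is preserved. *)

(** * Convexity *)

Lemma convex_setP (R : realType) d (S : set 'cV[R]_d) :
  @convex_set R 'cV[R]_d S <->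
  forall (s t : R) x y, 0 <= s -> 0 <= t -> s + t = 1 -> S x -> S y ->
    S (s *: x + t *: y).
Proof.
split=> [cS s t x y s0 t0 st1 Sx Sy|cS x y l /set_mem Sx /set_mem Sy].
- have s1 : s <= 1 by lra.
  have tE : 1 - s = t by lra.
  have /set_mem := cS x y (Itv01 s0 s1) (mem_set Sx) (mem_set Sy).
  by rewrite -tE.
- apply: mem_set; apply: cS => //.
  + by rewrite subr_ge0.
  + exact: etrans (addrC _ _) (subrK _ _).
Qed.

Lemma convex_conv_hull (R : realType) d (S : set 'cV[R]_d) :
  @convex_set R 'cV[R]_d (conv_hull S).
Proof.
apply/convex_setP => s t x y s0 t0 st1 Sx Sy V [cV SV].
by move/convex_setP: (cV); apply=> //; [apply: Sx|apply: Sy].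
Qed.

(** * Linear systems and their projections *)

Section LinearSystems.
Variables (R : realType) (d q : nat).

Lemma lin_sysI m1 m2 (A1 : 'M[R]_(m1, d)) (B1 : 'M[R]_(m1, q)) b1
    (A2 : 'M[R]_(m2, d)) (B2 : 'M[R]_(m2, q)) b2 :
  lin_sys A1 B1 b1 `&` lin_sys A2 B2 b2 =
  lin_sys (col_mx A1 A2) (col_mx B1 B2) (col_mx b1 b2).
Proof.
apply/seteqP; split=> [[x z] [/= h1 h2] i|[x z] /= h].
- rewrite /= !mul_col_mx add_col_mx.
  by case: (split_ordP i) => k ->; rewrite ?col_mxEu ?col_mxEd.
- split=> i /=.
  + by have := h (lshift m2 i); rewrite /= !mul_col_mx add_col_mx !col_mxEu.
  + by have := h (rshift m1 i); rewrite /= !mul_col_mx add_col_mx !col_mxEd.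
Qed.

Lemma convex_proj_lin_sys m (A : 'M[R]_(m, d)) (B : 'M[R]_(m, q)) b :
  @convex_set R 'cV[R]_d [set x | exists z, lin_sys A B b (x, z)].
Proof.
apply/convex_setP => s t x y s0 t0 st1 [z hz] [w hw].
exists (s *: z + t *: w) => i /=.
have := lerD (ler_wpM2l s0 (hz i)) (ler_wpM2l t0 (hw i)).
rewrite !mulmxDr -!scalemxAr !mxE /=.
have : s * b i 0 + t * b i 0 = b i 0 by rewrite -mulrDl st1 mul1r.
set a := (A *m x) i 0; set a' := (B *m z) i 0.
set c := (A *m y) i 0; set c' := (B *m w) i 0.
lra.
Qed.

End LinearSystems.

(** * Subsets of the unit cube *)

Lemma finite_binary_vectors (R : realType) n : finite_set (@binary_vectors R n).
Proof.
apply: (@sub_finite_set _ _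
  [set map_mx (fun c : bool => c%:R) M | M in [set: 'cV[bool]_n]]); last first.
  exact/finite_image/finite_finset.
move=> x xb; exists (\col_j (x j 0 == 1)) => //=.
apply/colP=> j; rewrite !mxE.
by case: (xb j) => ->; rewrite ?eqxx// eq_sym oner_eq0.
Qed.

Lemma conv_hull_binary (R : realType) n (F : set 'cV[R]_n) :
  F `<=` @binary_vectors R n ->
  conv_hull F `<=` [set x | forall j, 0 <= x j 0 <= 1].
Proof.
move=> Fb; apply: smallest_sub => [|x /Fb xb j]; last first.
  by case: (xb j) => ->; rewrite ?lexx ?ler01.
apply/convex_setP => s t x y s0 t0 st1 hx hy j.
by rewrite !mxE; move: (hx j) (hy j) => /andP[? ?] /andP[? ?]; apply/andP; nra.
Qed.

(** A set containing a ray is unbounded; the step 2 / |y_j| moves coordinate [j]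
    by 2, which is more than the cube allows. *)
Lemma recession_unit_cube (R : realType) n (x y : 'cV[R]_n) :
  (forall s, 0 <= s -> forall j, 0 <= (x + s *: y) j 0 <= 1) -> y = 0.
Proof.
move=> h; apply/colP => j; rewrite mxE; apply/eqP; apply: contraT => yj0.
have s0 : 0 <= 2 / `|y j 0| by rewrite divr_ge0.
have := h 0 (lexx _) j; have := h _ s0 j; rewrite !mxE mul0r addr0.
have : `|2 / `|y j 0| * y j 0| = 2.
  by rewrite normrM ger0_norm// divfK// normr_eq0.
set c := 2 / _ * _ => c2 /andP[? ?] /andP[? ?].
have : `|c| <= 1 by rewrite ler_norml; apply/andP; lra.
by rewrite c2; lra.
Qed.

(** * The perspective map onto choice probabilities *)

Section ChoiceProbabilities.
Variables (R : realType) (n : nat) (u0 : R) (u : 'I_n -> R).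

(** The normalizing constant of the choice model: with assortment [x], item j is
    chosen with probability u_j x_j / weight x. *)
Definition weight (x : 'cV[R]_n) : R := u0 + \sum_(j < n) u j * x j 0.

(** The point where the line spanned by (1, x) meets H, if [weight x != 0]. *)
Definition choice_vector (x : 'cV[R]_n) : 'cV[R]_(1 + n) :=
  (weight x)^-1 *: col_mx 1%:M x.

Lemma y0_part_col_mx (a : 'M[R]_1) (x : 'cV[R]_n) :
  y0_part (col_mx a x) = a 0 0.
Proof. by rewrite /y0_part col_mxKu. Qed.

Lemma y_part_col_mx (a : 'M[R]_1) (x : 'cV[R]_n) : y_part (col_mx a x) = x.
Proof. by rewrite /y_part col_mxKd. Qed.

Lemma y_parts_inj (Y Z : 'cV[R]_(1 + n)) :
  y0_part Y = y0_part Z -> y_part Y = y_part Z -> Y = Z.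
Proof.
move=> h0 h; rewrite -(vsubmxK Y) -(vsubmxK Z); congr col_mx => //.
by apply/matrixP => i j; rewrite !ord1.
Qed.

Lemma y0_part_scale c (Y : 'cV[R]_(1 + n)) :
  y0_part (c *: Y) = c * y0_part Y.
Proof. by rewrite /y0_part !mxE. Qed.

Lemma y_part_scale c (Y : 'cV[R]_(1 + n)) : y_part (c *: Y) = c *: y_part Y.
Proof. by apply/colP => j; rewrite !mxE. Qed.

Lemma y0_part_choice_vector x : y0_part (choice_vector x) = (weight x)^-1.
Proof. by rewrite y0_part_scale y0_part_col_mx mxE eqxx mulr1. Qed.

Lemma y_part_choice_vector x :
  y_part (choice_vector x) = (weight x)^-1 *: x.
Proof. by rewrite y_part_scale y_part_col_mx. Qed.

Lemma weight_binary_gt0 (x : 'cV[R]_n) :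
  0 < u0 -> (forall j, 0 <= u j) -> binary_vectors x -> 0 < weight x.
Proof.
move=> u0_gt0 u_ge0 xb; rewrite ltr_wpDr// sumr_ge0// => j _.
by rewrite mulr_ge0//; case: (xb j) => ->.
Qed.

Lemma weight_conv s t (x y : 'cV[R]_n) : s + t = 1 ->
  weight (s *: x + t *: y) = s * weight x + t * weight y.
Proof.
move=> st1; rewrite /weight !mulrDr !mulr_sumr addrACA -mulrDl st1 mul1r.
rewrite -big_split /=; congr (_ + _); apply: eq_bigr => j _.
by rewrite !mxE; ring.
Qed.

Lemma hyperplaneH_scale c (x : 'cV[R]_n) (Y : 'cV[R]_(1 + n)) :
  y0_part Y = c -> y_part Y = c *: x ->
  (hyperplaneH u0 u Y <-> c * weight x = 1).
Proof.
rewrite /hyperplaneH /weight /= => -> ->; rewrite mulrDr mulr_sumr mulrC.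
have -> // : \sum_(j < n) u j * (c *: x) j 0 = \sum_(j < n) c * (u j * x j 0).
by apply: eq_bigr => j _; rewrite !mxE; ring.
Qed.

Lemma hyperplaneH_choice_vector x :
  0 < weight x -> hyperplaneH u0 u (choice_vector x).
Proof.
move=> w0; apply/(hyperplaneH_scale (y0_part_choice_vector x)
  (y_part_choice_vector x)).
by rewrite mulVf// gt_eqF.
Qed.

(** On the line spanned by (1, x), the equation of H determines the scaling
    factor y_0. *)
Lemma choice_vector_unique x (Y : 'cV[R]_(1 + n)) :
  0 < weight x -> hyperplaneH u0 u Y -> y_part Y = y0_part Y *: x ->
  choice_vector x = Y.
Proof.
move=> w0 HY yY; move/(hyperplaneH_scale erefl yY): HY => cw.
have cE : (weight x)^-1 = y0_part Y by rewrite -[LHS]mul1r -cw mulfK// gt_eqF.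
by apply: y_parts_inj;
  rewrite ?y0_part_choice_vector ?y_part_choice_vector cE.
Qed.

Lemma choice_probE (F : set 'cV[R]_n) : (forall x, F x -> 0 < weight x) ->
  choice_prob u0 u F = [set choice_vector x | x in F].
Proof.
move=> wF; apply/seteqP; split=> [Y [HY [x Fx yY] y0]|_ [x Fx <-]].
- by exists x => //; apply: choice_vector_unique; [exact: wF| |].
- have w0 := wF _ Fx; split.
  + exact: hyperplaneH_choice_vector.
  + by exists x; rewrite // y0_part_choice_vector y_part_choice_vector.
  + by rewrite y0_part_choice_vector invr_gt0.
Qed.

(** Projective maps preserve convex combinations up to reweighting: multiplying
    through by the weight of the combination leaves s (1, x) + t (1, y). *)
Lemma choice_vector_conv s t x y :
  0 < weight x -> 0 < weight y -> s + t = 1 ->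
  0 < weight (s *: x + t *: y) ->
  choice_vector (s *: x + t *: y) =
  (s * weight x / weight (s *: x + t *: y)) *: choice_vector x +
  (t * weight y / weight (s *: x + t *: y)) *: choice_vector y.
Proof.
move=> wx wy st1 wxy; rewrite /choice_vector !scalerA.
set W := weight (s *: x + t *: y) in wxy *.
have cancel r v : 0 < v -> r * v / W / v = W^-1 * r.
  by move=> v0; field; rewrite !gt_eqF.
rewrite !cancel// -!scalerA -scalerDr; congr (_ *: _).
rewrite !scale_col_mx add_col_mx; congr col_mx.
by rewrite -scalerDl st1 scale1r.
Qed.

(** The points of positive weight whose image lies in the target hull form a
    convex set containing F. *)
Lemma choice_vector_conv_hull (F : set 'cV[R]_n) :
  (forall x, F x -> 0 < weight x) ->
  conv_hull F `<=`
  [set x | 0 < weight x /\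
           conv_hull [set choice_vector x | x in F] (choice_vector x)].
Proof.
move=> wF; apply: smallest_sub => [|x Fx]; last first.
  by split; [exact: wF|apply: sub_gen_smallest; exists x].
apply/convex_setP => s t x y s0 t0 st1 [wx cx] [wy cy].
have wxy : 0 < weight (s *: x + t *: y).
  rewrite weight_conv//; have [s_gt0|s_le0] := ltP 0 s.
    by rewrite ltr_wpDr ?mulr_gt0// mulr_ge0// ltW.
  have -> : s = 0 by lra.
  by have -> : t = 1; [lra|rewrite mul0r add0r mul1r].
split=> //; rewrite choice_vector_conv//.
move/convex_setP: (@convex_conv_hull R _ [set choice_vector x | x in F]).
apply=> //.
- by rewrite !mulr_ge0// ?invr_ge0 ltW.
- by rewrite !mulr_ge0// ?invr_ge0 ltW.
- by rewrite -mulrDl -weight_conv// divff// gt_eqF.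
Qed.

(** * The homogenized system *)

Definition homogenization m q (A : 'M[R]_(m, n)) (B : 'M[R]_(m, q))
    (b : 'cV[R]_m) : set ('cV[R]_(1 + n) * 'cV[R]_q) :=
  [set Yz | [/\ forall i, (A *m y_part Yz.1 + B *m Yz.2) i 0
                            <= (y0_part Yz.1 *: b) i 0,
                hyperplaneH u0 u Yz.1
              & 0 <= y0_part Yz.1]].

Lemma row_mul_parts k (a : 'cV[R]_k) (A : 'M[R]_(k, n)) (Y : 'cV[R]_(1 + n)) :
  row_mx a A *m Y = y0_part Y *: a + A *m y_part Y.
Proof.
rewrite -[in LHS](vsubmxK Y) mul_row_col.
have -> : a *m usubmx Y = y0_part Y *: a; last by [].
by apply/colP => i; rewrite !mxE big_ord1 mulrC /y0_part !mxE.
Qed.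

(** The three extra rows are the equation of H, counted as two opposite
    inequalities, and the sign condition on y_0. *)
Lemma homogenization_lin_sys m q (A : 'M[R]_(m, n)) (B : 'M[R]_(m, q))
    (b : 'cV[R]_m) :
  exists (A' : 'M[R]_(m + 3, 1 + n)) (B' : 'M[R]_(m + 3, q))
    (b' : 'cV[R]_(m + 3)), homogenization A B b = lin_sys A' B' b'.
Proof.
pose h : 'rV[R]_(1 + n) := row_mx u0%:M (\row_j u j).
suff -> : homogenization A B b =
    lin_sys (row_mx (- b) A) B 0 `&` (lin_sys h 0 1%:M `&`
    (lin_sys (- h) 0 (- 1%:M) `&` lin_sys (row_mx (- 1%:M) 0) 0 0)).
  by rewrite !lin_sysI; do 3 eexists.
have hE (Y : 'cV[R]_(1 + n)) :
    (h *m Y) 0 0 = u0 * y0_part Y + \sum_(j < n) u j * y_part Y j 0.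
  rewrite row_mul_parts mxE mxE mxE eqxx mulrC; congr (_ + _).
  by rewrite mxE; apply: eq_bigr => j _; rewrite !mxE.
have h1 (Y : 'cV[R]_(1 + n)) (z : 'cV[R]_q) :
    lin_sys (row_mx (- b) A) B 0 (Y, z) <->
    forall i, (A *m y_part Y + B *m z) i 0 <= (y0_part Y *: b) i 0.
  by split=> h' i; have := h' i; rewrite /= row_mul_parts !mxE; lra.
have h2 (Y : 'cV[R]_(1 + n)) (z : 'cV[R]_q) :
    lin_sys h 0 1%:M (Y, z) <-> (h *m Y) 0 0 <= 1.
  split=> [/(_ 0)|h' i]; first by rewrite /= mul0mx addr0 [X in _ <= X]mxE eqxx.
  by rewrite /= mul0mx addr0 ord1 [X in _ <= X]mxE eqxx.
have h3 (Y : 'cV[R]_(1 + n)) (z : 'cV[R]_q) :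
    lin_sys (- h) 0 (- 1%:M) (Y, z) <-> 1 <= (h *m Y) 0 0.
  have -> : (1 <= (h *m Y) 0 0) =
      ((- h *m Y + (0 : 'M_(1, q)) *m z) 0 0 <= (- 1%:M : 'M[R]_1) 0 0).
    rewrite mul0mx addr0 mulNmx [X in _ = (X <= _)]mxE [X in _ = (_ <= X)]mxE.
    by rewrite [X in _ = (_ <= - X)]mxE eqxx lerN2.
  by split=> [/(_ 0)|h' i] //; rewrite ord1.
have h4 (Y : 'cV[R]_(1 + n)) (z : 'cV[R]_q) :
    lin_sys (row_mx (- 1%:M) 0) 0 0 (Y, z) <-> 0 <= y0_part Y.
  split=> [/(_ 0)|h' i].
    by rewrite /= row_mul_parts !mul0mx !addr0 !mxE eqxx mulr1n; lra.
  by rewrite /= row_mul_parts !mul0mx !addr0 ord1 !mxE eqxx mulr1n; lra.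
apply/seteqP; split=> [[Y z] [/= hA hH h0]|
                       [Y z] [/h1 hA [/h2 hle [/h3 hge /h4 h0]]]].
- split; first exact/h1.
  by split; [apply/h2; rewrite hE hH|split; [apply/h3; rewrite hE hH|exact/h4]].
- by split=> //; rewrite /hyperplaneH /= -hE; apply/eqP; rewrite eq_le hle hge.
Qed.

(** The projection is convex and contains Pi(F), which gives one inclusion.  For
    the other, points with y_0 > 0 rescale into conv(F), and y_0 = 0 is excluded
    because conv(F) is nonempty and bounded. *)
Lemma proj_homogenization (F : set 'cV[R]_n) m q
    (A : 'M[R]_(m, n)) (B : 'M[R]_(m, q)) (b : 'cV[R]_m) :
  0 < u0 -> (forall j, 0 <= u j) ->
  F `<=` @binary_vectors R n -> F !=set0 ->
  conv_hull F = [set x | exists z, lin_sys A B b (x, z)] ->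
  conv_hull [set choice_vector x | x in F] =
  [set Y | exists z, homogenization A B b (Y, z)].
Proof.
move=> u0_gt0 u_ge0 Fb [x0 Fx0] convE.
have wF x : F x -> 0 < weight x.
  by move=> /Fb; exact: weight_binary_gt0.
apply/seteqP; split.
- apply: smallest_sub.
    have [A' [B' [b' ->]]] := homogenization_lin_sys A B b.
    exact: convex_proj_lin_sys.
  move=> _ [x Fx <-]; have w0 := wF _ Fx.
  have : conv_hull F x by apply: sub_gen_smallest.
  rewrite convE => -[z hz]; exists ((weight x)^-1 *: z).
  split=> [i||] /=.
  + rewrite y0_part_choice_vector y_part_choice_vector.
    rewrite -!scalemxAr -scalerDr mxE [X in _ <= X]mxE.
    by rewrite ler_pM2l ?invr_gt0//; apply: hz.
  + exact: hyperplaneH_choice_vector.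
  + by rewrite y0_part_choice_vector invr_ge0 ltW.
- move=> Y [z [/= hA hH]]; rewrite le_eqVlt => /orP[/eqP y00|y0_gt0].
  + have y0 : y_part Y = 0.
      (* The whole ray from x0 in direction y stays in conv(F). *)
      have : conv_hull F x0 by apply: sub_gen_smallest.
      rewrite convE => -[z0 hz0].
      apply: (@recession_unit_cube _ _ x0) => s s0.
      apply: (conv_hull_binary Fb); rewrite convE; exists (z0 + s *: z) => i /=.
      have := hA i; have := hz0 i; rewrite /= -y00 scale0r.
      rewrite !mulmxDr -!scalemxAr !mxE /=.
      set p := (\sum__ A _ _ * y_part _ _ _); set p' := (\sum__ B _ _ * z _ _).
      by move=> ? /(ler_wpM2l s0); lra.
    move: hH; rewrite /hyperplaneH /= -y00 y0 mulr0 add0r big1 => [/esym/eqP|].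
      by rewrite oner_eq0.
    by move=> j _; rewrite mxE mulr0.
  + set c := y0_part Y in hA y0_gt0; pose x := c^-1 *: y_part Y.
    have c0 : c != 0 by rewrite gt_eqF.
    have yE : y_part Y = c *: x by rewrite scalerA divff// scale1r.
    have : conv_hull F x.
      rewrite convE; exists (c^-1 *: z) => i /=.
      rewrite -!scalemxAr -scalerDr mxE.
      by rewrite ler_pdivrMl//; have := hA i; rewrite [X in _ <= X]mxE.
    move/(choice_vector_conv_hull wF) => [w0].
    by rewrite (choice_vector_unique w0 hH yE).
Qed.

Lemma extended_formulation_homogenization (F : set 'cV[R]_n) m q
    (A : 'M[R]_(m, n)) (B : 'M[R]_(m, q)) (b : 'cV[R]_m) :
  0 < u0 -> (forall j, 0 <= u j) ->
  F `<=` @binary_vectors R n -> F !=set0 ->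
  extended_formulation m (lin_sys A B b) (conv_hull F) ->
  extended_formulation (m + 3) (homogenization A B b)
    (conv_hull (choice_prob u0 u F)).
Proof.
move=> u0_gt0 u_ge0 Fb F0 [_ _ convE].
have -> : choice_prob u0 u F = [set choice_vector x | x in F].
  by apply: choice_probE => x /Fb; exact: weight_binary_gt0.
split.
- exists [set choice_vector x | x in F] => //.
  exact/finite_image/(sub_finite_set Fb)/finite_binary_vectors.
- exact: homogenization_lin_sys.
- exact: proj_homogenization.
Qed.

End ChoiceProbabilities.

Theorem theorem2 (R : realType) :
  (forall (n : nat) (u0 : R) (u : 'I_n -> R) (F : set 'cV[R]_n)
     (m q : nat) (A : 'M[R]_(m, n)) (B : 'M[R]_(m, q)) (b : 'cV[R]_m),
     0 < u0 -> (forall j, 0 <= u j) ->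
     F `<=` @binary_vectors R n -> F !=set0 ->
     extended_formulation m (lin_sys A B b) (conv_hull F) ->
     extended_formulation (m + 3)
       [set Yz : 'cV[R]_(1 + n) * 'cV[R]_q |
          [/\ forall i, (A *m y_part Yz.1 + B *m Yz.2) i 0
                          <= (y0_part Yz.1 *: b) i 0,
              hyperplaneH u0 u Yz.1
            & 0 <= y0_part Yz.1]]
       (conv_hull (choice_prob u0 u F)))
  /\
  (forall (u0 : nat -> R) (u : forall n : nat, 'I_n -> R)
     (F : forall n : nat, set 'cV[R]_n),
     (forall n, 0 < u0 n) -> (forall n j, 0 <= u n j) ->
     (forall n, F n `<=` @binary_vectors R n) -> (forall n, F n !=set0) ->
     has_compact_ef (fun n => conv_hull (F n)) ->
     has_compact_ef (fun n => conv_hull (choice_prob (u0 n) (@u n) (F n)))).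
Proof.
split=> [n u0 u F m q A B b|u0 u F u0_gt0 u_ge0 Fb F0 [p hp]].
  exact: extended_formulation_homogenization.
exists (p + 3%:P) => n; have [q [m [Q [qp mp ef]]]] := hp n.
have [_ [A [B [b QE]]] _] := ef; rewrite QE in ef.
exists q, (m + 3)%N, (homogenization (u0 n) (@u n) A B b).
rewrite hornerD hornerC; split.
- exact: leq_trans qp (leq_addr _ _).
- by rewrite leq_add2r.
- exact: extended_formulation_homogenization.
Qed.
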